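(* Let $\alpha\ge 3$, put $q=\alpha-1$, and consider the attractive sign $\sigma=+1$. Let $f\ge 0$ be a sufficiently regular solution on an interval $[0,T_* )$, $0<T_*\le\infty$, of $$\partial_t f+v\cdot\nabla_x f+E[f]\cdot\nabla_v f=0,\qquad E[f]=K_\alpha*\rho_f,$$ with finite second spatial moment $I(t)$, for which the conservation of energy and the virial identity are justified, that is, for all $t\in[0,T_* )$, $$H_+(t)=H_+(0),\qquad I''(t)=4H_+(t)+2(2-q)\,U(t).$$ If the conserved energy is negative, $H_+(0)<0$, then such a solution cannot exist globally in time, i.e. $T_*<\infty$.
   Context: Here $d\geq 1$ is the space dimension, $f=f(t,x,v)$ with $x,v\in\mathbb R^d$, $c_{d,\alpha}>0$ is a fixed constant, $K_\alpha(x)=-c_{d,\alpha}\,x/|x|^{\alpha+1}$, and $\rho_f(t,x)=\rho(t,x)=\int_{\mathbb R^d} f(t,x,v)\,dv$. With $W_q(x)=\frac{c_{d,\alpha}}{q}|x|^{-q}$ one has $K_\alpha=\nabla W_q$ away from $0$. When $q<d-1$ the convolution $K_\alpha*\rho$ is understood in the ordinary sense; when $d-1\le q<d$ it is understood in the principal-value/distributional sense. Define $$K(t)=\tfrac12\iint |v|^2 f(t,x,v)\,dx\,dv,\qquad U(t)=\tfrac12\iint W_q(x-y)\rho(t,x)\rho(t,y)\,dx\,dy,$$ $$H_+(t)=K(t)-U(t),\qquad I(t)=\iint |x|^2 f(t,x,v)\,dx\,dv.$$ ''Sufficiently regular'' means that $f$ solves the equation (in the sense of distributions, with $E[f]f$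 locally integrable), that $K(t),U(t),I(t)$ are finite for all $t\in[0,T_* )$, that $I$ is twice continuously differentiable, and that the two displayed identities hold. *)

(* Defs.v *)
From HB Require Import structures.
From mathcomp Require Import all_boot all_order all_algebra.
From mathcomp Require Import all_classical all_reals all_analysis.

Set Implicit Arguments.
Unset Strict Implicit.
Unset Printing Implicit Defensive.

Import Order.TTheory GRing.Theory Num.Theory.
Import numFieldNormedType.Exports.

Local Open Scope classical_set_scope.
Local Open Scope ring_scope.

Definition measure_rV_display : measure_display -> measure_display.
Proof. exact. Qed.

Section measurable_rV.
Context {d} {T : measurableType d} (n : nat).

Let coors : 'I_n -> 'rV[T]_n -> T := fun i x => x ord0 i.

Let rV_set0 : g_sigma_preimage coors set0.
Proof. exact: sigma_algebra0. Qed.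

Let rV_setC A : g_sigma_preimage coors A -> g_sigma_preimage coors (~` A).
Proof. exact: sigma_algebraC. Qed.

Let rV_bigcup (F : _^nat) : (forall i, g_sigma_preimage coors (F i)) ->
  g_sigma_preimage coors (\bigcup_i (F i)).
Proof. exact: sigma_algebra_bigcup. Qed.

HB.instance Definition _ := @isMeasurable.Build (measure_rV_display d)
  'rV[T]_n (g_sigma_preimage coors) rV_set0 rV_setC rV_bigcup.

End measurable_rV.

Section measurable_rV_fun.
Context d1 d2 (T1 : measurableType d1) (T2 : measurableType d2).

Lemma measurable_coord n (i : 'I_n) :
  measurable_fun [set: 'rV[T2]_n] (fun x => x ord0 i).
Proof.
move=> _ Y mY; rewrite setTI; apply: sub_sigma_algebra => /=.
rewrite -bigcup_seq/=; exists i => /=; first by rewrite mem_index_enum.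
by exists Y => //; rewrite setTI.
Qed.

Lemma measurable_fun_rVP n (f : T1 -> 'rV[T2]_n) :
  measurable_fun [set: T1] f <->
  forall i, measurable_fun [set: T1] (fun t => f t ord0 i).
Proof.
apply: (@iff_trans _ (g_sigma_preimage
    (fun i => (fun x : 'rV[T2]_n => x ord0 i) \o f) `<=` measurable)).
  rewrite g_sigma_preimage_comp; split=> [mf A [/= C preC <-]|prefS].
    exact: mf.
  by move=> _ A mA; apply: prefS; exists A.
split=> [fS i|mf].
- move=> _ A mA.
  apply: fS; apply: sub_sigma_algebra.
  rewrite -bigcup_seq/=; exists i => /=; first by rewrite mem_index_enum.
  by exists A => //; rewrite setTI.
- apply: smallest_sub; first exact: sigma_algebra_measurable.
  rewrite -bigcup_seq/=; apply: bigcup_sub => i Ii.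
  by move=> A [B mB <-]; exact: mf.
Qed.

End measurable_rV_fun.

(* The library's sigma-finite instance on [\x] is shadowed by the one for
   products of subprobabilities, hence this restatement. *)
Lemma sigma_finite_prod d1 d2 (T1 : measurableType d1) (T2 : measurableType d2)
    (R : realType) (m1 : {sigma_finite_measure set T1 -> \bar R})
    (m2 : {sigma_finite_measure set T2 -> \bar R}) :
  sigma_finite setT (m1 \x m2)%E.
Proof.
have /sigma_finiteP[F [TF ndF Foo]] := sigma_finiteT m1.
have /sigma_finiteP[G [TG ndG Goo]] := sigma_finiteT m2.
exists (fun n => F n `*` G n).
  rewrite -setXTT TF TG predeqE => -[x y]; split.
    move=> [/= [n _ Fnx] [k _ Gky]]; exists (maxn n k) => //; split.
    - by move: x Fnx; exact/subsetPset/ndF/leq_maxl.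
    - by move: y Gky; exact/subsetPset/ndG/leq_maxr.
  by move=> [n _ []/= ? ?]; split; exists n.
move=> k; have [? ?] := Foo k; have [? ?] := Goo k.
split; first exact: measurableX.
by rewrite product_measure1E// lte_mul_pinfty// ge0_fin_numE.
Qed.

Section rV_cons_measure.
Context {R : realType} (n : nat).

Definition rV_cons (p : measurableTypeR R * 'rV[R]_n) : 'rV[R]_n.+1 :=
  \row_j (if unlift ord0 j is Some k then p.2 ord0 k else p.1).

Definition rV_uncons (x : 'rV[R]_n.+1) : measurableTypeR R * 'rV[R]_n :=
  (x ord0 ord0, \row_k x ord0 (lift ord0 k)).

Lemma rV_consK : cancel rV_cons rV_uncons.
Proof.
move=> [a x]; rewrite /rV_uncons /rV_cons !mxE unlift_none/=.
by congr pair; apply/rowP => k; rewrite !mxE liftK.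
Qed.

Lemma measurable_rV_cons : measurable_fun setT rV_cons.
Proof.
apply/measurable_fun_rVP => i; rewrite /rV_cons.
case: (unliftP ord0 i) => [k ->|->].
  apply: (eq_measurable_fun (fun p : measurableTypeR R * 'rV[R]_n => p.2 ord0 k)).
    by move=> p _; rewrite mxE liftK.
  exact: (measurableT_comp (measurable_coord k) measurable_snd).
apply: (eq_measurable_fun (fun p : measurableTypeR R * 'rV[R]_n => p.1)).
  by move=> p _; rewrite mxE unlift_none.
exact: measurable_fst.
Qed.

Lemma measurable_rV_uncons : measurable_fun setT rV_uncons.
Proof.
apply/measurable_fun_pairP; split; first exact: measurable_coord.
apply/measurable_fun_rVP => k /=.
apply: (eq_measurable_fun (fun x : 'rV[R]_n.+1 => x ord0 (lift ord0 k))).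
  by move=> p _; rewrite /= mxE.
exact: measurable_coord.
Qed.

Variable mu : {sigma_finite_measure set 'rV[R]_n -> \bar R}.

Definition rV_cons_measure : set 'rV[R]_n.+1 -> \bar R :=
  pushforward (@lebesgue_measure R \x mu)%E rV_cons.

Let rV_cons_measure0 : rV_cons_measure set0 = 0%E.
Proof. by rewrite /rV_cons_measure /pushforward preimage_set0 measure0. Qed.

Let rV_cons_measure_ge0 A : (0 <= rV_cons_measure A)%E.
Proof. by rewrite /rV_cons_measure /pushforward measure_ge0. Qed.

Let rV_cons_measure_sigma_additive : semi_sigma_additive rV_cons_measure.
Proof.
move=> F mF tF mUF; rewrite /rV_cons_measure /pushforward preimage_bigcup.
apply: measure_semi_sigma_additive.
- by move=> k; rewrite -[X in measurable X]setTI; exact: measurable_rV_cons.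
- apply/trivIsetP => /= i j _ _ ij; rewrite -preimage_setI.
  by move/trivIsetP : tF => /(_ _ _ _ _ ij) ->//; rewrite preimage_set0.
- rewrite -preimage_bigcup -[X in measurable X]setTI.
  exact: measurable_rV_cons.
Qed.

HB.instance Definition _ := isMeasure.Build _ _ _ rV_cons_measure
  rV_cons_measure0 rV_cons_measure_ge0 rV_cons_measure_sigma_additive.

Let rV_cons_measure_sigma_finite : sigma_finite setT rV_cons_measure.
Proof.
pose m1 : {sigma_finite_measure set (measurableTypeR R) -> \bar R} :=
  @lebesgue_measure R.
have [F FT mF] : sigma_finite setT (m1 \x mu)%E by exact: sigma_finite_prod.
exists (fun k => rV_uncons @^-1` F k); first by rewrite -preimage_bigcup -FT.
move=> k; have [mFk Fkoo] := mF k; split.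
  by rewrite -[X in measurable X]setTI; exact: measurable_rV_uncons.
rewrite /rV_cons_measure /pushforward -comp_preimage.
by rewrite (_ : _ \o _ = id) //; apply/funext => p /=; rewrite rV_consK.
Qed.

HB.instance Definition _ := Measure_isSigmaFinite.Build _ _ _ rV_cons_measure
  rV_cons_measure_sigma_finite.

End rV_cons_measure.

(* Lebesgue measure on R^n: R^n.+1 is R x R^n, up to [rV_cons]. *)
Fixpoint leb {R : realType} (n : nat) :
    {sigma_finite_measure set 'rV[R]_n -> \bar R} :=
  match n with
  | 0 => @dirac _ 'rV[R]_0 0 R
  | m.+1 => rV_cons_measure (leb m)
  end.

Lemma measurable_box (R : realType) n (A : 'I_n -> set R) :
  (forall i, measurable (A i)) ->
  measurable [set x : 'rV[R]_n | forall i, A i (x ord0 i)].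
Proof.
move=> mA.
rewrite (_ : [set _ | _] = \bigcap_(i in [set: 'I_n])
  ((fun x : 'rV[R]_n => x ord0 i) @^-1` A i)).
  apply: fin_bigcap_measurable => // i _.
  by rewrite -[X in measurable X]setTI; exact: measurable_coord.
by apply/seteqP; split=> x /= h => [i _|i]; apply: h.
Qed.

Lemma leb_box (R : realType) n (A : 'I_n -> set R) :
  (forall i, measurable (A i)) ->
  leb n [set x : 'rV[R]_n | forall i, A i (x ord0 i)] =
  (\prod_(i < n) @lebesgue_measure R (A i))%E.
Proof.
elim: n A => [|n IH] A mA /=.
  by rewrite big_ord0 diracE mem_set//= => -[].
rewrite big_ord_recl /rV_cons_measure /pushforward.
rewrite (_ : _ @^-1` _ = A ord0 `*`
  [set x : 'rV[R]_n | forall i, A (lift ord0 i) (x ord0 i)]).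
  rewrite product_measure1E//; [|exact: mA|]; last
    exact: (measurable_box (A := fun i => A (lift ord0 i))).
  by congr (_ * _)%E; exact: (IH (fun i => A (lift ord0 i))).
rewrite predeqE => -[a x]; split=> /= [h|[ha h] i].
  split; first by have := h ord0; rewrite mxE unlift_none.
  by move=> i; have := h (lift ord0 i); rewrite mxE liftK.
by rewrite mxE; case: unliftP => [k ->|->].
Qed.

Section phase_measure.
Context {R : realType} (d : nat).

Definition phase_leb : set ('rV[R]_d * 'rV[R]_d) -> \bar R :=
  (leb d \x leb d)%E.

HB.instance Definition _ := Measure.on phase_leb.
HB.instance Definition _ := Measure_isSigmaFinite.Build _ _ _ phase_leb
  (sigma_finite_prod (leb d) (leb d)).

End phase_measure.
Arguments phase_leb {R} d _.

Section kernels.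
Context {R : realType} {d : nat}.
Implicit Type x : 'rV[R]_d.

(* The library norm `|x| of a row vector is the sup norm. *)
Definition enorm x : R := Num.sqrt (\sum_(i < d) x ord0 i ^+ 2).

(* Both kernels are 0 at the origin, by the conventions of [powR] and of the
   inverse; they are only ever integrated, and {0} is negligible for d > 0. *)
Definition Kker (c alpha : R) x : 'rV[R]_d :=
  - (c / enorm x `^ (alpha + 1)) *: x.

Definition Wker (c q : R) x : R := c / q * enorm x `^ (- q).

End kernels.

Section test_functions.
Context {R : realType} {V : normedModType R}.
Implicit Types (phi : V -> R) (D : set V).

(* Class C^k through iterated directional derivatives; in finite dimension
   this is the usual notion. *)
Fixpoint Ck (k : nat) phi : Prop :=
  match k with
  | 0 => continuous phi
  | m.+1 => (forall x h, derivable phi x h) /\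
            (forall h, Ck m (fun x => 'D_h phi x))
  end.

Definition test_function D phi :=
  [/\ forall k, Ck k phi,
      compact (closure [set x | phi x != 0]) &
      closure [set x | phi x != 0] `<=` D].

End test_functions.

Section phase_space.
Context {R : realType} {d : nat}.

(* The densities below are those of a fixed time: g x v = f t x v. *)
Implicit Types (g : 'rV[R]_d -> 'rV[R]_d -> R) (rho : 'rV[R]_d -> \bar R).

Definition density g (x : 'rV[R]_d) : \bar R := (\int[leb d]_v (g x v)%:E)%E.

Definition kinetic g : \bar R :=
  ((2^-1)%:E * \int[phase_leb d]_z (enorm z.2 ^+ 2 * g z.1 z.2)%:E)%E.

Definition potential (c q : R) g : \bar R :=
  ((2^-1)%:E * \int[phase_leb d]_z
     ((Wker c q (z.1 - z.2))%:E * density g z.1 * density g z.2))%E.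

Definition inertia g : \bar R :=
  (\int[phase_leb d]_z (enorm z.1 ^+ 2 * g z.1 z.2)%:E)%E.

(* Total energy; meaningful when both terms are finite. *)
Definition energy (c q : R) g : R := fine (kinetic g) - fine (potential c q g).

Definition conv_ordinary (c alpha : R) rho (F : 'rV[R]_d -> 'rV[R]_d) : Prop :=
  {ae leb d, forall x, forall i,
    (leb d).-integrable setT
      (fun y => (Kker c alpha (x - y) ord0 i)%:E * rho y)%E /\
    (F x ord0 i)%:E = (\int[leb d]_y
      ((Kker c alpha (x - y) ord0 i)%:E * rho y))%E}.

(* F is the convolution of rho with the distribution p.v. Kker:
   <F, phi> = \int rho(y) <p.v. Kker, phi(y + .)> dy. As Kker is odd, the limit
   defining the principal value exists for every test function as soon as
   alpha - 1 < d. *)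
Definition conv_pv (c alpha : R) rho (F : 'rV[R]_d -> 'rV[R]_d) : Prop :=
  (forall i, measurable_fun setT (fun x => F x ord0 i) /\
     forall C : set 'rV[R]_d, compact C ->
       (\int[leb d]_(x in C) `|F x ord0 i|%:E < +oo)%E) /\
  forall (phi : 'rV[R]_d -> R) i, test_function setT phi ->
    exists P : 'rV[R]_d -> R,
      [/\ forall y, (\int[leb d]_(z in [set z | e < enorm z])
             (Kker c alpha z ord0 i * phi (y + z))) @[e --> 0^'+] --> P y,
          (leb d).-integrable setT (fun y => (P y)%:E * rho y)%E &
          (\int[leb d]_x (F x ord0 i * phi x)%:E =
           \int[leb d]_y ((P y)%:E * rho y))%E].

End phase_space.

Section equation.
Context {R : realType} {d : nat}.
Variables (T : \bar R) (f : R -> 'rV[R]_d -> 'rV[R]_d -> R)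
  (E : R -> 'rV[R]_d -> 'rV[R]_d).

(* E = K_alpha * rho_f. The usual setting is alpha - 1 < d; no upper bound on
   alpha is imposed here. *)
Definition is_field (c alpha : R) : Prop :=
  {ae lebesgue_measure, forall t : R, 0 < t -> (t%:E < T)%E ->
    (alpha - 1 < d%:R - 1 ->
       conv_ordinary c alpha (density (f t)) (E t)) /\
    (d%:R - 1 <= alpha - 1 ->
       conv_pv c alpha (density (f t)) (E t))}.

Let spacetime : set (R * ('rV[R]_d * 'rV[R]_d)) :=
  [set p | 0 < p.1 /\ (p.1%:E < T)%E].

Let mu := (@lebesgue_measure R \x phase_leb d)%E.

Let loc_integrable (h : R * ('rV[R]_d * 'rV[R]_d) -> R) :=
  measurable_fun spacetime h /\
  forall C, compact C -> C `<=` spacetime ->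
    (\int[mu]_(p in C) `|h p|%:E < +oo)%E.

(* E does not depend on v, so E . grad_v f = div_v (E f) and the equation is in
   divergence form; v . grad_x phi and E . grad_v phi are the directional
   derivatives of phi along (0, (v, 0)) and (0, (0, E)). *)
Definition weak_solution : Prop :=
  [/\ loc_integrable (fun p => f p.1 p.2.1 p.2.2),
      forall i, loc_integrable
        (fun p => E p.1 p.2.1 ord0 i * f p.1 p.2.1 p.2.2) &
      forall phi, test_function spacetime phi ->
        (\int[mu]_(p in spacetime)
           (f p.1 p.2.1 p.2.2 *
             ('D_(1, (0, 0)) phi p + 'D_(0, (p.2.2, 0)) phi p
              + 'D_(0, (0, E p.1 p.2.1)) phi p))%:E = 0)%E].

End equation.

Section derivative_on.
Context {R : realType}.
Implicit Types (D : set R) (F : R -> R).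

(* Derivative relative to D: one-sided at an endpoint belonging to D. *)
Definition diff_quotient F (t s : R) : R := (F s - F t) / (s - t).

Definition derivable_on D F :=
  forall t, D t -> cvg (diff_quotient F t @ within D t^').

Definition derive_on D F (t : R) : R := lim (diff_quotient F t @ within D t^').

Definition C2_on D F :=
  [/\ derivable_on D F, derivable_on D (derive_on D F) &
      {within D, continuous (derive_on D (derive_on D F))}].

End derivative_on.

(* Main.v *)
(* For q >= 2 and U >= 0 the virial identity gives I'' <= 4 H(0) < 0. On an
   unbounded time interval a function with such a second derivative becomes
   negative, whereas I >= 0. *)
Require Import Defs.
From mathcomp Require Import all_boot all_order all_algebra.
From mathcomp Require Import all_classical all_reals all_analysis.
From mathcomp Require Import lra.

Set Implicit Arguments.
Unset Strict Implicit.
Unset Printing Implicit Defensive.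

Import Order.TTheory GRing.Theory Num.Theory.
Import numFieldNormedType.Exports.

Local Open Scope classical_set_scope.
Local Open Scope ring_scope.

(** Suppose the solution is global. Since [q >= 2] and [U >= 0], the virial identity bounds [I'']
    above by a negative constant. A function whose derivative stays below a negative constant on a
    half-line ends up below any prescribed level ([is_derive_le_eventually_le]). Applied to [I'] and
    then to [I], this makes [I] negative at late times, against [inertia_ge0]. The first two lemmas
    turn derivatives relative to [J] into ordinary ones, so that the mean value theorem applies. *)

Lemma within_dnbhs_interior (T : topologicalType) (D : set T) (t : T) :
  D° t -> within D t^' = t^'.
Proof.
move=> Dt; apply/seteqP; split => A; last exact: cvg_within.
move=> wA.
have wAt : \forall y \near t, y != t -> D y -> A y by [].
have tD : \forall y \near t, D y by [].
have : \forall y \near t, y != t -> A y.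
  by apply: filterS2 wAt tD => y yA Dy yt; exact: yA.
by [].
Qed.

(** Substituting [s = t + h] turns [diff_quotient] into the usual quotient in [h], and at an
    interior point the restriction to [D] does not change the limit. *)
Lemma is_derive_derive_on (R : realType) (D : set R) (F : R -> R) (t : R) :
  D° t -> cvg (diff_quotient F t @ within D t^') ->
  is_derive t 1 F (derive_on D F t).
Proof.
move=> Dt cF.
have Fl : (fun h => h^-1 *: ((F \o shift t) (h *: 1) - F t)) @ 0^' -->
    derive_on D F t.
  have -> : (fun h => h^-1 *: ((F \o shift t) (h *: 1) - F t)) =
      diff_quotient F t \o (fun h => h + t).
    apply/funext => h /=.
    by rewrite /diff_quotient addrK /GRing.scale /= mulr1 mulrC.
  apply: cvg_comp; last first.
    by move: cF; rewrite /derive_on within_dnbhs_interior//; exact.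
  move=> A tA.
  have {}tA : \forall y \near t, y != t -> A y by [].
  have ct : (h + t) @[h --> (0 : R)] --> t.
    by rewrite -[X in _ --> X]add0r; apply: cvgD; [exact: cvg_id|exact: cvg_cst].
  have : \forall h \near (0 : R), h != 0 -> A (h + t).
    have ctA : \forall h \near (0 : R), h + t != t -> A (h + t) := ct _ tA.
    apply: filterS ctA => h hA h0; apply: hA.
    by rewrite -subr_eq0 addrK.
  by [].
by apply: DeriveDef; [apply/cvg_ex; exists (derive_on D F t)|exact: cvg_lim].
Qed.

Lemma is_derive_le_eventually_le (R : realType) (G dG : R -> R) (a k M : R) :
  0 < k ->
  (forall t, a < t -> is_derive t 1 G (dG t)) ->
  (forall t, a < t -> dG t <= - k) ->
  exists2 b, a < b & forall t, b < t -> G t <= M.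
Proof.
(* The hypotheses hold only to the right of [a], while the mean value theorem needs continuity on a
   closed interval: start at [s > a]. *)
move=> k0 derG dGk; pose s := a + 1.
have as_ : a < s by rewrite /s ltrDl.
(* Falling at rate at least [k], [G] drops from [G s] to [M] within time [|G s - M| / k]. *)
exists (s + `|G s - M| / k) => [|t bt].
  by rewrite (lt_le_trans as_)// lerDl divr_ge0// ltW.
have st : s < t by rewrite (le_lt_trans _ bt)// lerDl divr_ge0// ltW.
have [||x] := @MVT R G dG s t st.
- by move=> x; rewrite in_itv/= => /andP[sx _]; apply: derG; exact: lt_trans sx.
- apply: derivable_within_continuous => x; rewrite in_itv/= => /andP[sx _].
  by have [] := derG x (lt_le_trans as_ sx).
rewrite in_itv/= => /andP[sx _] Gts.
have dGx : dG x * (t - s) <= - k * (t - s).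
  by apply: ler_wpM2r; [rewrite subr_ge0 ltW|apply: dGk; exact: lt_trans sx].
have kts : `|G s - M| < k * (t - s).
  by move: bt; rewrite -ltrBrDl ltr_pdivrMr// mulrC.
have := ler_norm (G s - M); lra.
Qed.

Lemma potential_ge0 (R : realType) (d : nat) (c q : R)
    (g : 'rV[R]_d -> 'rV[R]_d -> R) :
  0 <= c -> 0 <= q -> (forall x v, 0 <= g x v) -> (0 <= potential c q g)%E.
Proof.
move=> c0 q0 g0; rewrite /potential mule_ge0//.
have dens0 x : (0 <= density g x)%E.
  by apply: integral_ge0 => v _; rewrite lee_fin.
apply: integral_ge0 => z _; rewrite !mule_ge0//.
by rewrite lee_fin mulr_ge0 ?divr_ge0 ?powR_ge0.
Qed.

Lemma inertia_ge0 (R : realType) (d : nat) (g : 'rV[R]_d -> 'rV[R]_d -> R) :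
  (forall x v, 0 <= g x v) -> (0 <= inertia g)%E.
Proof.
move=> g0; apply: integral_ge0 => z _.
by rewrite lee_fin mulr_ge0 ?sqr_ge0.
Qed.

Theorem theorem1p3 (R : realType) (d : nat) (alpha q c : R) (T : \bar R)
    (f : R -> 'rV[R]_d -> 'rV[R]_d -> R) (E : R -> 'rV[R]_d -> 'rV[R]_d) :
  let J := [set t : R | 0 <= t /\ (t%:E < T)%E] in
  let U := fun t => fine (potential c q (f t)) in
  let H := fun t => energy c q (f t) in
  let I := fun t => fine (inertia (f t)) in
  (0 < d)%N -> 3 <= alpha -> q = alpha - 1 -> 0 < c -> (0 < T)%E ->
  (forall t x v, J t -> 0 <= f t x v) ->
  (forall t, J t -> measurable_fun setT (fun z => f t z.1 z.2)) ->
  is_field T f E c alpha ->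
  weak_solution T f E ->
  (forall t, J t -> [/\ kinetic (f t) \is a fin_num,
                       potential c q (f t) \is a fin_num &
                       inertia (f t) \is a fin_num]) ->
  C2_on J I ->
  (forall t, J t -> H t = H 0) ->
  (forall t, J t ->
     derive_on J (derive_on J I) t = 4 * H t + 2 * (2 - q) * U t) ->
  H 0 < 0 ->
  (T < +oo)%E.
Proof.
move=> J U H I d0 alpha3 qE c0 T0 f0 _ _ _ _ [dI ddI _] HE virial H0.
rewrite ltey; apply/eqP => Too.
have Jge0 (t : R) : 0 <= t -> J t by move=> t0; split => //; rewrite Too ltry.
have Jint (t : R) : 0 < t -> J° t.
  move=> t0; rewrite /interior /=; apply: filterS (lt_nbhsr t0) => s /ltW.
  exact: Jge0.
have dI1 (t : R) : 0 < t -> is_derive t 1 I (derive_on J I t).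
  move=> t0; apply: is_derive_derive_on; first exact: Jint.
  by apply: dI; exact/Jge0/ltW.
have dI2 (t : R) : 0 < t ->
    is_derive t 1 (derive_on J I) (derive_on J (derive_on J I) t).
  move=> t0; apply: is_derive_derive_on; first exact: Jint.
  by apply: ddI; exact/Jge0/ltW.
have I2le (t : R) : 0 < t -> derive_on J (derive_on J I) t <= - (- (4 * H 0)).
  move=> /ltW /Jge0 Jt; rewrite virial// HE//.
  have U0 : 0 <= U t.
    apply: fine_ge0; apply: potential_ge0; [exact: ltW|lra|].
    by move=> x v; exact: f0.
  (* What remains is [2 * (2 - q) * U t <= 0]; here [alpha >= 3] gives [2 - q <= 0]. *)
  rewrite opprK gerDl mulr_le0_ge0//; lra.
(* The level -1 reached by [I'] after [b] serves as the decay rate [k = 1] for [I]. *)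
have [|b b0 I1le] := is_derive_le_eventually_le (-1) _ dI2 I2le; first lra.
have [|||e be Ie] := @is_derive_le_eventually_le R I (derive_on J I) b 1 (-1).
- exact: ltr01.
- by move=> t bt; apply: dI1; exact: lt_trans bt.
- exact: I1le.
have e0 : 0 <= e + 1 by lra.
have I0 : 0 <= I (e + 1).
  apply: fine_ge0; apply: inertia_ge0 => x v; apply: f0; exact: Jge0.
have : I (e + 1) <= -1 by apply: Ie; rewrite ltrDl.
lra.
Qed.
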